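(* Each maximal (with respect to inclusion) cellular finitary coarse structure on $\omega$ is indiscrete. Consequently, $\mathsf{\Delta}_\omega^\circ\le\mathfrak c$.
   Context: An entourage on a set $X$ is a set $E\subseteq X\times X$ containing the diagonal $\Delta_X$; $E^{-1}=\{(y,x):(x,y)\in E\}$, $EF=\{(x,z):\exists y\ (x,y)\in E,(y,z)\in F\}$, $E(x)=\{y:(x,y)\in E\}$. A coarse structure on $X$ is a family $\mathcal E$ of entourages on $X$ such that $\bigcup\mathcal E=X\times X$; for any $E,F\in\mathcal E$ there is $T\in\mathcal E$ with $EF^{-1}\subseteq T$; and every entourage contained in a member of $\mathcal E$ belongs to $\mathcal E$. A base of $\mathcal E$ is a subfamily $\mathcal B\subseteq\mathcal E$ such that each $E\in\mathcal E$ is contained in some $B\in\mathcal B$; the weight $w(\mathcal E)$ is the smallest cardinality of a base. $\mathcal E$ is cellular if it has a base consisting of equivalence relations; finitary if $\sup_{x\in X}|E(x)|$ is finite for every $E\in\mathcal E$. A maximal cellular finitary coarse structure is one not properly contained in another cellular finitary coarse structure on the same set. A set $A\subseteq X$ is $\mathcal E$-bounded if $A\subseteq E(x)$ for some $E\in\mathcal E$, $x\in X$; $\mathcal E$-discrete if for every $E\in\mathcal E$ the set $\{x\in A:A\cap E(x)\ne\{x\}\}$ is $\mathcal E$-bounded. A coarse structure $\mathcal E$ for which $X$ is not $\mathcal E$-bounded is indiscrete if each $\mathcal E$-discrete subset of $X$ is $\mathcal E$-bounded. $\mathfrak c=2^{\aleph_0}$, $\mathfrak c^+$ is its cardinal successor,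 and $\mathsf{\Delta}^\circ_\omega=\min(\{\mathfrak c^+\}\cup\{w(\mathcal E):\mathcal E$ is an indiscrete cellular finitary coarse structure on $\omega\})$. *)

(* Defs.v *)
From mathcomp Require Import all_boot all_order all_classical.

Set Implicit Arguments.
Unset Strict Implicit.
Unset Printing Implicit Defensive.

Local Open Scope classical_set_scope.
Local Open Scope card_scope.

Section Coarse.
Context {X : Type}.
Implicit Types (A : set X) (E F : set (X * X)) (EE : set (set (X * X))).

Definition is_entourage E := diagonal `<=` E.

(* [F \; E] of [relation_scope] is the set of the pairs [(x, z)] such that
   [E (x, y)] and [F (y, z)] for some [y], i.e. the product "E F". *)
Record coarse_structure EE : Prop := CoarseStructure {
  coarse_entourage : forall E, EE E -> is_entourage E;
  coarse_cover : \bigcup_(E in EE) E = [set: X * X];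
  coarse_mul_inv : forall E F, EE E -> EE F ->
    exists2 T, EE T & (F^-1 \; E)%relation `<=` T;
  coarse_sub : forall E F, EE E -> is_entourage F -> F `<=` E -> EE F }.

Definition is_base EE (B : set (set (X * X))) :=
  B `<=` EE /\ forall E, EE E -> exists2 F, B F & E `<=` F.

Definition cellular EE := exists2 B, is_base EE B &
  forall E, B E -> RelationClasses.Equivalence (fun x y => E (x, y)).

Definition finitary EE :=
  forall E, EE E -> exists n : nat, forall x, xsection E x #<= `I_n.

Definition cellular_finitary EE :=
  [/\ coarse_structure EE, cellular EE & finitary EE].

Definition maximal_cellular_finitary EE :=
  cellular_finitary EE /\
  forall EE', cellular_finitary EE' -> ~ (EE `<` EE').

Definition bounded EE A :=
  exists E x, EE E /\ A `<=` xsection E x.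

Definition discrete EE A := forall E, EE E ->
  bounded EE [set x | A x /\ A `&` xsection E x <> [set x]].

Definition indiscrete EE :=
  ~ bounded EE [set: X] /\ forall A, discrete EE A -> bounded EE A.

End Coarse.

(* A cardinal is represented by any set having that cardinality; cardinals
   are compared by [#<=] and identified by [#=]. *)

Definition card_lt T U (A : set T) (B : set U) := A #<= B /\ ~ (B #<= A).

(* A set of least cardinality in [F] (by [card_minP], the default [set0] is
   only reached for [F = set0]). *)
Definition card_min U (F : set (set U)) : set U :=
  xget set0 [set A | F A /\ forall B, F B -> A #<= B].

Lemma card_min_ex U (F : set (set U)) : F !=set0 ->
  exists A, F A /\ forall B, F B -> A #<= B.
Proof.
move=> [A0 FA0].
pose P (G : set (set U -> U)) :=
  (forall f A, G f -> F A -> A (f A)) /\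
  (forall f g A, G f -> G g -> F A -> f A = g A -> f = g).
have [G [[G1 G2] Gmax]] : exists G, P G /\ forall H, G `<` H -> ~ P H.
  apply: Zorn_bigcup => C CP Ctot; split.
    by move=> f A [H CH Hf] FA; exact: (proj1 (CP _ CH) f A Hf FA).
  move=> f g A [H CH Hf] [K CK Kg] FA fg.
  have [HK|KH] := Ctot _ _ CH CK.
    exact: (proj2 (CP _ CK) f g A (HK _ Hf) Kg).
  exact: (proj2 (CP _ CH) f g A Hf (KH _ Kg)).
have [A [FA Asurj]] : exists A, F A /\ forall a, A a -> exists2 f, G f & f A = a.
  apply: contrapT => nA.
  have miss A : F A -> exists a, A a /\ forall f, G f -> f A <> a.
    move=> FA; apply: contrapT => na; apply: nA; exists A; split=> // a Aa.
    apply: contrapT => nf; apply: na; exists a; split=> // f Gf fA.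
    by apply: nf; exists f.
  have [u0 _] := miss _ FA0.
  have /choice[h hP] : forall A, exists a,
      F A -> A a /\ forall f, G f -> f A <> a.
    move=> A; have [FA|nFA] := pselect (F A); last by exists u0.
    by have [a aP] := miss _ FA; exists a.
  have GH : G `<` G `|` [set h].
    split; first by move=> f; left.
    move=> /(_ h (or_intror erefl)) Gh.
    by have [_ /(_ h Gh)] := hP _ FA0.
  apply: (Gmax _ GH); split=> [f A [Gf|->] FA|f g A [Gf|->] [Gg|->] FA //].
  - exact: (G1 f A Gf FA).
  - exact: (hP _ FA).1.
  - exact: (G2 f g A Gf Gg FA).
  - by move=> fh; have [_ /(_ f Gf)] := hP _ FA.
  - by move=> hg; have [_ /(_ g Gg)] := hP _ FA; rewrite hg.
exists A; split=> // B FB.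
have /choice[s sP] : forall a, exists f, A a -> G f /\ f A = a.
  move=> a; have [Aa|nAa] := pselect (A a); last by exists (fun=> a).
  by have [f Gf fA] := Asurj _ Aa; exists f.
suff [k] : $|{injfun A >-> B}| by exact: inj_card_le k.
apply/injfunPex; exists (fun a => s a B).
  by move=> a Aa; have [Ga _] := sP _ Aa; exact: (G1 _ _ Ga FB).
move=> a b /set_mem Aa /set_mem Ab sab.
have [[Ga sa] [Gb sb]] := (sP _ Aa, sP _ Ab).
by rewrite -sa -sb (G2 _ _ _ Ga Gb FB sab).
Qed.

Lemma card_minP U (F : set (set U)) : F !=set0 ->
  F (card_min F) /\ forall B, F B -> card_min F #<= B.
Proof. by move=> /card_min_ex/xgetPex; exact. Qed.

Lemma card_le_total T U (A : set T) (B : set U) : (A #<= B) || (B #<= A).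
Proof.
have il : @inl T U @` A #= A by apply: inj_card_eq => x y _ _ [].
have ir : @inr T U @` B #= B by apply: inj_card_eq => x y _ _ [].
have [C [[->|->] Cmin]] :=
  @card_min_ex (T + U)%type [set inl @` A; inr @` B]
    (ex_intro _ _ (or_introl erefl)).
- by have := Cmin _ (or_intror erefl); rewrite (card_le_eql il) (card_le_eqr ir) => ->.
- have := Cmin _ (or_introl erefl).
  by rewrite (card_le_eql ir) (card_le_eqr il) => ->; rewrite orbT.
Qed.

(* By Cantor's theorem, a cardinal greater than that of [K : set U] is found
   among the sets of subsets of [U]; by [card_succP] the result is least among
   the sets of all types. *)
Definition card_succ U (K : set U) : set (set U) :=
  card_min [set S : set (set U) | card_lt K S].

Lemma card_lt_setT U (K : set U) : card_lt K [set: set U].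
Proof.
split.
  apply: (card_le_trans (card_leT K)).
  have i : set1 @` [set: U] #= [set: U].
    by apply: inj_card_eq => x y _ _ /seteqP[/(_ x erefl)].
  by rewrite -(card_le_eql i); exact: card_leT.
move=> /card_le_trans/(_ (card_leT K))/card_leP[g].
pose f x := g (SigSub (mem_set (I : [set: set U] x))).
have finj x y : f x = f y -> x = y.
  by move=> /(@inj _ _ _ g _ _ (mem_set I) (mem_set I)) [].
pose D := [set u : U | exists2 x : set U, u = val (f x) & ~ x u].
have [Du|nDu] := pselect (D (val (f D))).
  by have [x /val_inj/finj <-] := Du.
by apply: (nDu); exists D.
Qed.

Lemma card_succP U (K : set U) : card_lt K (card_succ K) /\
  forall V (L : set V), card_lt K L -> card_succ K #<= L.
Proof.
have [KS Smin] := card_minP (ex_intro _ _ (card_lt_setT K)).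
split=> // V L [KL nLK].
have [//|LS] := orP (card_le_total (card_succ K) L).
have /card_leP[g] := card_le_trans LS (card_leT (card_succ K)).
pose M : set (set U) := [set val (g l) | l in [set: L]].
have ML : M #= L.
  apply: (card_eq_trans _ (card_setT L)); apply: inj_card_eq => x y xL yL /val_inj.
  exact: (@inj _ _ _ g).
rewrite -(card_le_eqr ML); apply: Smin; split; first by rewrite (card_le_eqr ML).
by rewrite (card_le_eql ML).
Qed.

Definition weight X (EE : set (set (X * X))) : set (set (X * X)) :=
  card_min [set B | is_base EE B].

Lemma weightP X (EE : set (set (X * X))) : is_base EE (weight EE) /\
  forall B, is_base EE B -> weight EE #<= B.
Proof.
by apply: card_minP; exists EE; split=> // E EEE; exists E.
Qed.

Definition continuum : set (set nat) := [set: set nat].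

(* The type [set (set nat)] is large enough to contain a representative of
   each cardinal of the family, see [DeltaP]. *)
Definition Delta_family : set (set (set (set nat))) :=
  [set D | D #= card_succ continuum \/
    exists EE : set (set (nat * nat)),
      [/\ cellular_finitary EE, indiscrete EE & D #= weight EE]].

Definition Delta : set (set (set nat)) := card_min Delta_family.

Lemma DeltaP : [/\ Delta_family Delta, Delta #<= card_succ continuum &
  forall EE : set (set (nat * nat)), cellular_finitary EE -> indiscrete EE ->
    Delta #<= weight EE].
Proof.
have [DF Dmin] : Delta_family Delta /\ forall B, Delta_family B -> Delta #<= B.
  by apply: card_minP; exists (card_succ continuum); left; exact: card_eqxx.
split=> //; first by apply: Dmin; left; exact: card_eqxx.
move=> EE EEcf EEi.
pose h (E : set (nat * nat)) : set (set nat) := [set pickle @` E].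
have hW : h @` weight EE #= weight EE.
  apply: inj_card_eq => E F _ _ /seteqP[/(_ _ erefl) pEF _].
  apply/seteqP; split=> x Ex.
    have : (pickle @` F) (pickle x) by rewrite -pEF; exists x.
    by move=> [y Fy /(pcan_inj pickleK) <-].
  have : (pickle @` E) (pickle x) by rewrite pEF; exists x.
  by move=> [y Fy /(pcan_inj pickleK) <-].
by rewrite -(card_le_eqr hW); apply: Dmin; right; exists EE; split.
Qed.

(* Main.v *)
Require Import Defs.
From mathcomp Require Import all_boot all_order all_classical.

Local Open Scope classical_set_scope.
Local Open Scope card_scope.

(** Let [EE] be a maximal cellular finitary structure and suppose that some
    infinite set [A] is discrete.  Choose an involution [f] that moves
    infinitely many points, all of them in [A].  Its graph, together with the
    diagonal, is not in [EE], since it connects infinitely many points of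
    [A] to other points of [A].  But it can be added to [EE] without losing
    cellularity or finitarity, which contradicts maximality.

    To add it, glue the classes of each equivalence [E] of [EE] along [f]: join
    the class of [y] to the class of [f y] ([glue]).  By discreteness all but
    finitely many classes of [E] contain at most one moved point, and such a
    class is glued to at most one other.  The moved points in the exceptional
    classes and their images under [f] form a finite set; after enlarging [E]
    within [EE] so that this set lies in one class, [E] is [adapted] to [f], and
    a single round of gluing already gives an equivalence ([glue_equiv]).  Its
    classes are uniformly finite since it is built from uniformly finite
    relations by composition.  Adapted equivalences are cofinal in [EE]
    ([adapted_cofinal]), so the glued relations generate a cellular finitary
    structure containing [EE] and the graph of [f].

    Maximal structures exist by Zorn's lemma, and every structure on a countable
    set is a family of subsets of a countable set, so it has weight at most the
    continuum.  This bounds [Delta]. *)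

(** * Uniformly finite relations *)

Notation equiv E := (RelationClasses.Equivalence (fun x y => E (x, y))).

Definition uniformly_finite {X : Type} (E : set (X * X)) :=
  exists n : nat, forall x, xsection E x #<= `I_n.

Lemma card_le_II_cover {X : Type} (x0 : X) (A : set X) (n : nat) :
  A #<= `I_n -> exists f : nat -> X, A `<=` f @` `I_n.
Proof.
move=> /ocard_geP[f]; exists (fun i => odflt x0 (f i)) => a Aa.
have [i ni fi] : (f @` `I_n) (Some a) by apply: (@surj _ _ _ _ f); exists a.
by exists i => //; rewrite fi.
Qed.

(** Listing each section by a function on [`I_n] makes products of relations
    easy to bound. *)
Lemma uniformly_finiteP {X : Type} (E : set (X * X)) :
  uniformly_finite E <-> exists (n : nat) (f : X -> nat -> X),
    forall x y, E (x, y) -> exists2 i, (i < n)%N & f x i = y.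
Proof.
split=> [[n En]|[n [f fE]]]; exists n.
  have /choice[f fP] x := card_le_II_cover x _ _ (En x).
  by exists f => x y Exy; apply: fP; apply/xsectionP.
move=> x; apply: card_le_trans (card_image_le (f x) `I_n).
by apply: subset_card_le => y /xsectionP /fE.
Qed.

Lemma uniformly_finiteS {X : Type} (E F : set (X * X)) :
  E `<=` F -> uniformly_finite F -> uniformly_finite E.
Proof.
move=> EF [n Fn]; exists n => x; apply: card_le_trans (Fn x).
exact/subset_card_le/le_xsection.
Qed.

Lemma uniformly_finiteU {X : Type} (E F : set (X * X)) :
  uniformly_finite E -> uniformly_finite F -> uniformly_finite (E `|` F).
Proof.
move=> /uniformly_finiteP[n [f fE]] /uniformly_finiteP[m [g gF]].
apply/uniformly_finiteP; exists (n + m)%N.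
exists (fun x i => if (i < n)%N then f x i else g x (i - n)%N) => x y.
move=> [/fE[i ni <-]|/gF[i mi <-]].
  by exists i; rewrite ?ni // ltn_addr.
by exists (n + i)%N; rewrite ?ltn_add2l // addKn ltnNge leq_addr.
Qed.

Lemma uniformly_finite_comp {X : Type} (E F : set (X * X)) :
  uniformly_finite E -> uniformly_finite F ->
  uniformly_finite (F \; E)%relation.
Proof.
move=> /uniformly_finiteP[n [f fE]] /uniformly_finiteP[m [g gF]].
apply/uniformly_finiteP; exists (n * m)%N.
exists (fun x k => g (f x (k %/ m)) (k %% m)) => x z /=.
move=> [y /fE[i ni <-] /gF[j mj <-]].
have m0 : (0 < m)%N by apply: leq_ltn_trans mj.
exists (i * m + j)%N; last by rewrite divnMDl // divn_small // addn0 modnMDl modn_small.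
by apply: (@leq_trans (i.+1 * m)); rewrite ?leq_mul2r ?ni ?orbT // mulSn addnC ltn_add2r.
Qed.

Lemma uniformly_finite_graph {X : Type} (f : X -> X) :
  uniformly_finite [set xy | xy.2 = f xy.1].
Proof.
by apply/uniformly_finiteP; exists 1, (fun x _ => f x) => x y /= ->; exists 0.
Qed.

Lemma uniformly_finite_square {X : Type} (D : set X) :
  finite_set D -> uniformly_finite (D `*` D).
Proof.
move=> /finite_set_leP[n Dn]; exists n => x; apply: card_le_trans Dn.
by apply: subset_card_le => y /xsectionP[].
Qed.

(** * Cellular finitary structures and their equivalences *)

Definition generated {X : Type} (B : set (set (X * X))) : set (set (X * X)) :=
  [set E | is_entourage E /\ exists2 F, B F & E `<=` F].

Lemma generated_cellular_finitary {X : Type} (B : set (set (X * X))) :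
  (forall E, B E -> equiv E) ->
  (forall E F, B E -> B F -> exists2 G, B G & E `|` F `<=` G) ->
  \bigcup_(E in B) E = setT ->
  (forall E, B E -> uniformly_finite E) ->
  cellular_finitary (generated B).
Proof.
move=> Beq Bdir Bcov Bfin.
have Bgen E : B E -> generated B E.
  move=> BE; split; last by exists E.
  by move=> [x y] /= /diagonalP ->; have [r _ _] := Beq _ BE; exact: r.
split; first split.
- by move=> E [].
- apply/seteqP; split=> // p _; have : [set: X * X] p by [].
  by rewrite -Bcov => -[E BE Ep]; exists E => //; exact: Bgen.
- move=> E F [_ [E1 BE1 EE1]] [_ [F1 BF1 FF1]].
  have [G BG sG] := Bdir _ _ BE1 BF1; exists G; first exact: Bgen.
  have [_ Gs Gt] := Beq _ BG.
  move=> [x z] /= [y Exy Fzy]; apply: (Gt x y z); first by apply: sG; left; exact: EE1.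
  by apply: Gs; apply: sG; right; exact: FF1.
- move=> E F [_ [E1 BE1 EE1]] Fent FE; split=> //.
  by exists E1 => // p /FE /EE1.
- exists B => //; split; first exact: Bgen.
  by move=> E [_ [F BF EF]]; exists F.
- move=> E [_ [F BF EF]]; apply: uniformly_finiteS EF _; exact: Bfin.
Qed.

Section CellularFinitary.
Context {X : Type} {EE : set (set (X * X))}.
Hypothesis EEcf : cellular_finitary EE.

Lemma cellular_finitary_directed E F : EE E -> EE F ->
  exists G, [/\ EE G, equiv G & E `|` F `<=` G].
Proof.
have [[ent _ mulinv _] [B [BEE Bbase] Beq] _] := EEcf => EEE EEF.
have [T /Bbase[G BG TG] sT] := mulinv _ _ EEE EEF.
exists G; split; [exact: BEE|exact: Beq|].
have [_ Gs _] := Beq _ BG.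
move=> [x y] [Exy|Fxy].
  by apply/TG/sT; exists y => //; apply: (ent _ EEF).
by apply/Gs/TG/sT; exists y => //=; apply: (ent _ EEE).
Qed.

Lemma cellular_finitary_pair (p : X * X) : exists2 E, EE E & E p.
Proof.
have [[_ cov _ _] _ _] := EEcf; have : [set: X * X] p by [].
by rewrite -cov => -[E]; exists E.
Qed.

Lemma cellular_finitary_nonempty (x : X) : exists E, EE E.
Proof. by have [E EEE _] := cellular_finitary_pair (x, x); exists E. Qed.

Lemma cellular_finitary_square (D : set X) : D !=set0 -> finite_set D ->
  exists G, [/\ EE G, equiv G & D `*` D `<=` G].
Proof.
move=> [x0 Dx0] /finite_set_leP[n /(card_le_II_cover x0)[f Df]].
suff [G [EEG Geq Gf]] : exists G,
    [/\ EE G, equiv G & forall i, (i < n)%N -> G (x0, f i)].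
  have [_ Gs Gt] := Geq; exists G; split=> // -[x y].
  move=> [/= /Df[i ni <-] /Df[j nj <-]].
  by apply: (Gt _ x0); [apply/Gs|]; exact: Gf.
clear Df; elim: n => [|n [G [EEG _ Gf]]].
  have [E EEE] := cellular_finitary_nonempty x0.
  by have [G [? ? _]] := cellular_finitary_directed _ _ EEE EEE; exists G; split.
have [E EEE En] := cellular_finitary_pair (x0, f n).
have [H [EEH Heq sH]] := cellular_finitary_directed _ _ EEG EEE.
exists H; split=> // i; rewrite ltnS leq_eqVlt => /orP[/eqP ->|/Gf ?].
  by apply: sH; right.
by apply: sH; left.
Qed.

Lemma finite_bounded (D : set X) : D !=set0 -> finite_set D -> bounded EE D.
Proof.
move=> D0 Dfin; have [x Dx] := D0.
have [G [EEG _ sG]] := cellular_finitary_square D D0 Dfin.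
by exists G, x; split=> // y Dy; apply/xsectionP/sG.
Qed.

Lemma bounded_finite (D : set X) : bounded EE D -> finite_set D.
Proof.
have [_ _ fin] := EEcf => -[E [x [/fin[n En] DE]]].
by apply: (sub_finite_set DE); apply/finite_set_leP; exists n.
Qed.

End CellularFinitary.

(** * Gluing along an involution *)

(** Transporting the successive transposition of [2n] and [2n+1] along an
    embedding of [nat] in [A] gives the involution. *)
Lemma infinite_set_involution {X : Type} (A : set X) : infinite_set A ->
  exists f : X -> X, [/\ involutive f, [set x | f x <> x] `<=` A &
    infinite_set [set x | f x <> x]].
Proof.
move=> Ainf; have [x0 _] := infinite_setN0 Ainf.
have [g gA ginj] : exists2 g : nat -> X, forall n, A (g n) & injective g.
  have /infiniteP/card_leP[h] := Ainf.
  exists (fun n => val (h (SigSub (mem_set (I : [set: nat] n))))).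
    by move=> n; apply: set_mem; apply: valP.
  move=> m n /val_inj.
  by move=> /(@inj _ _ _ h _ _ (mem_set I) (mem_set I))[].
pose s n := if odd n then n.-1 else n.+1.
have sK : involutive s.
  case=> [|n] //; rewrite /s /=.
  by case: (boolP (odd n)) => /= [h|/negPf h]; rewrite h.
have sn n : s n <> n.
  by rewrite /s; case: n => //= n; case: ifP => _ /eqP; rewrite ?eqn_leq ?ltnn ?andbF.
have /choice[f fP] x : exists y, (forall n, g n = x -> y = g (s n)) /\
    ((forall n, g n <> x) -> y = x).
  have [[n <-]|ng] := pselect (exists n, g n = x).
    by exists (g (s n)); split=> [m /ginj ->|/(_ n)].
  by exists x; split=> // n gn; case: ng; exists n.
have fg n : f (g n) = g (s n) by exact: (fP _).1.
have fg' x : f x <> x -> exists n, g n = x.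
  move=> fx; apply: contrapT => ng; apply: fx; apply: (fP x).2 => n gn.
  by apply: ng; exists n.
exists f; split=> [x|x /= /fg'[n <-] //|].
  have [|/fg'[n <-]] := pselect (f x = x); first by move=> fx; rewrite !fx.
  by rewrite !fg sK.
apply/infiniteP.
have gN : g @` setT #= [set: nat] by apply: inj_card_eq => m n _ _ /ginj.
rewrite -(card_le_eql gN); apply: subset_card_le => _ [n _ <-] /=.
by rewrite fg => /ginj /sn.
Qed.

Definition glue {X : Type} (f : X -> X) (E : set (X * X)) : set (X * X) :=
  E `|` [set xz | exists2 y, E (xz.1, y) & E (f y, xz.2)].

(** A class with two moved points must be stable under [f]; then gluing only
    joins disjoint pairs of classes. *)
Definition adapted {X : Type} (f : X -> X) (E : set (X * X)) :=
  forall x y, f x <> x -> f y <> y -> x <> y -> E (x, y) -> E (x, f x).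

Section Glue.
Context {X : Type} {f : X -> X}.
Hypothesis fK : involutive f.

Lemma glue_mono (E F : set (X * X)) : E `<=` F -> glue f E `<=` glue f F.
Proof. by move=> EF p [/EF|[y /EF ? /EF ?]]; [left|right; exists y]. Qed.

Lemma glue_uniformly_finite (E : set (X * X)) :
  uniformly_finite E -> uniformly_finite (glue f E).
Proof.
move=> Efin; apply: uniformly_finiteU => //.
have := uniformly_finite_comp _ _ (uniformly_finite_comp _ _ Efin
  (uniformly_finite_graph f)) Efin.
apply: uniformly_finiteS => -[x z] [y /= Exy Eyz].
by exists (f y) => //; exists y.
Qed.

Lemma glue_equiv (E : set (X * X)) :
  equiv E -> adapted f E -> equiv (glue f E).
Proof.
move=> [Er Es Et] Ead; split.
- by move=> x; left; exact: Er.
- move=> x z [/Es|[y /= Exy Eyz]]; first by left.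
  by right; exists (f y); rewrite /= ?fK; exact: Es.
move=> x y z [Exy|[u /= Exu Euy]] [Eyz|[v /= Eyv Evz]].
- by left; exact: Et Exy Eyz.
- by right; exists v => //=; exact: Et Exy Eyv.
- by right; exists u => //=; exact: Et Euy Eyz.
have Euv : E (f u, v) := Et _ _ _ Euy Eyv.
have [fuv|fuv] := pselect (f u = v).
  (* The second step undoes the first. *)
  by left; apply: (Et _ u) => //; rewrite -[u]fK fuv.
have [fu|fu] := pselect (f u = u).
  by right; exists v => //=; apply: (Et _ u) => //; rewrite -{1}fu.
have [fv|fv] := pselect (f v = v).
  by right; exists u => //=; apply: (Et _ v) => //; rewrite -{1}fv.
(* The class of [f u] and [v] has two moved points, so it contains the source
   [u] of the first step and the target [f v] of the second one. *)
have Efu : E (f u, u).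
  have := Ead (f u) v; rewrite fK; apply=> //.
  by move=> /esym.
have Efv : E (v, f v).
  by apply: (Ead v (f u)) => //; [rewrite fK => /esym|move=> /esym|exact: Es].
left; apply: (Et _ u) => //; apply: (Et _ (f u)); first exact: Es.
by apply: (Et _ v) => //; apply: (Et _ (f v)).
Qed.

(** The points to be put in one class are the moved points related to another
    moved point, and the images of these under [f]: a finite set, by
    discreteness.  A moved point in the new class is related to one of them,
    hence is one of them, so a single enlargement is enough. *)
Lemma adapted_cofinal {EE : set (set (X * X))} {A : set X} {E : set (X * X)} :
  cellular_finitary EE -> [set x | f x <> x] `<=` A -> discrete EE A ->
  EE E -> exists F, [/\ EE F, equiv F, adapted f F & E `<=` F].
Proof.
move=> EEcf fA Adis EEE0.
have [{EEE0}E1 [EEE Eeq sE]] := cellular_finitary_directed EEcf _ _ EEE0 EEE0.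
have {}sE : E `<=` E1 by move=> p Ep; apply: sE; left.
have [Er Es Et] := Eeq.
pose bad := [set x | f x <> x /\ exists y, [/\ f y <> y, x <> y & E1 (x, y)]].
have bad_fin : finite_set bad.
  apply: sub_finite_set (bounded_finite EEcf _ (Adis _ EEE)).
  move=> x [/= fx [y [fy xy Exy]]]; split; first exact: fA.
  move=> /seteqP[/(_ y) + _] => yx; apply: xy; apply/esym/yx.
  by split; [exact: fA|exact/xsectionP].
pose D := bad `|` f @` bad.
have Dmoved x : D x -> f x <> x.
  by move=> [[]//|[y [fy _] <-]]; rewrite fK => /esym.
have Df x : D x -> D (f x).
  by move=> [bx|[y bY <-]]; [right; exists x|left; rewrite fK].
have [D0|nD] := pselect (D !=set0); last first.
  exists E1; split=> // x y fx fy xy Exy; case: nD.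
  by exists x; left; split=> //; exists y.
have Dfin : finite_set D by rewrite finite_setU; split=> //; exact: finite_image.
have [G0 [EEG0 _ DG0]] := cellular_finitary_square EEcf _ D0 Dfin.
have [G [EEG Geq sG]] := cellular_finitary_directed EEcf _ _ EEE EEG0.
have [Gr Gs Gt] := Geq.
pose satD := [set x | exists2 d, D d & E1 (x, d)].
have satD_E x y : E1 (x, y) -> satD y -> satD x.
  by move=> Exy [d Dd Eyd]; exists d => //; exact: Et Eyd.
pose F := E1 `|` satD `*` satD.
have satD_moved x : satD x -> f x <> x -> D x.
  move=> [d Dd Exd] fx; have [->//|xd] := pselect (x = d).
  by left; split=> //; exists d; split=> //; exact: Dmoved.
have DsatD x : D x -> satD x by move=> Dx; exists x => //; exact: Er.
have FG : F `<=` G.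
  move=> [x y] [Exy|[/= [d Dd Exd] [e De Eye]]]; first by apply: sG; left.
  apply: (Gt _ d); first by apply: sG; left.
  apply: (Gt _ e); first by apply: sG; right; apply: DG0.
  by apply: Gs; apply: sG; left.
have Feq : equiv F.
  split.
  - by move=> x; left; exact: Er.
  - by move=> x y [/Es|[]]; [left|right].
  move=> x y z [Exy|[Sx Sy]] [Eyz|[Sy' Sz]].
  - by left; exact: Et Exy Eyz.
  - by right; split=> //=; exact: satD_E Exy _.
  - by right; split=> //=; apply: satD_E Sy; exact: Es.
  - by right.
exists F; split=> //; last by move=> p /sE; left.
  have [[_ _ _ EEsub] _ _] := EEcf.
  apply: EEsub EEG _ FG => -[x y] /diagonalP ->; left; exact: Er.
move=> x y fx fy xy Fxy; right.
suff Dx : D x by split; apply: DsatD => //; exact: Df.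
have [Exy|[Sx _]] := Fxy; first by left; split=> //; exists y.
exact: satD_moved.
Qed.

End Glue.

(** * Maximal structures *)

Theorem maximal_cellular_finitary_indiscrete {X : Type}
    {EE : set (set (X * X))} :
  infinite_set [set: X] -> maximal_cellular_finitary EE -> indiscrete EE.
Proof.
move=> Xinf [EEcf EEmax]; have [x0 _] := infinite_setN0 Xinf.
split=> [/(bounded_finite EEcf) //|A Adis].
have [Afin|/infinite_set_involution[f [fK fA finf]]] := pselect (finite_set A).
  have [[x Ax]|/nonemptyPn ->] := pselect (A !=set0).
    by apply: (finite_bounded EEcf) => //; exists x.
  by have [E EEE] := cellular_finitary_nonempty EEcf x0; exists E, x0; split.
have cof E (EEE : EE E) := adapted_cofinal fK EEcf fA Adis EEE.
pose B := glue f @` [set E | [/\ EE E, equiv E & adapted f E]].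
have genB E : is_entourage E -> (exists2 F, EE F & E `<=` glue f F) ->
    generated B E.
  move=> Eent [F /cof[G [EEG Geq Gad FG]] EF]; split=> //.
  by exists (glue f G); [exists G|exact: subset_trans EF (glue_mono _ _ FG)].
have ent E : EE E -> is_entourage E.
  by have [[h _ _ _] _ _] := EEcf; exact: h.
have Bcf : cellular_finitary (generated B).
  apply: generated_cellular_finitary.
  - by move=> _ [E [_ Eeq Ead] <-]; exact: glue_equiv.
  - move=> _ _ [E [EEE _ _] <-] [F [EEF _ _] <-].
    have [H [EEH _ sH]] := cellular_finitary_directed EEcf _ _ EEE EEF.
    have [G [EEG Geq Gad HG]] := cof _ EEH.
    exists (glue f G); first by exists G.
    by move=> p [] /glue_mono; apply=> q Eq; apply/HG/sH; [left|right].
  - apply/seteqP; split=> // p _.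
    have [E /cof[G [EEG Geq Gad EG]] Ep] := cellular_finitary_pair EEcf p.
    by exists (glue f G); [exists G|left; exact: EG].
  - move=> _ [E [EEE _ _] <-]; apply: glue_uniformly_finite.
    by have [_ _] := EEcf; exact.
have EEsub : EE `<=` generated B.
  by move=> E EEE; apply: genB; [exact: ent|exists E => // p; left].
have Bsub : generated B `<=` EE.
  by apply: contrapT => nsub; exact: (EEmax _ Bcf (conj EEsub nsub)).
pose R := [set xy : X * X | xy.2 = xy.1 \/ xy.2 = f xy.1].
have /Adis/(bounded_finite EEcf) bad_fin : EE R.
  apply: Bsub; apply: genB; first by move=> p /esym; left.
  have [E EEE] := cellular_finitary_nonempty EEcf x0; have {}ent := ent _ EEE.
  exists E => // -[x y] Rxy; have [->|->] : y = x \/ y = f x := Rxy.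
    by left; exact: ent.
  by right; exists x; exact: ent.
exfalso; apply: finf; apply: sub_finite_set bad_fin => x fx; split; first exact: fA.
move=> /seteqP[/(_ (f x)) + _] => fxx; apply: (fx); apply: fxx.
split; last by apply/xsectionP; right.
by apply: fA; rewrite /= fK => /esym.
Qed.

(** The equivalences with at most one nontrivial class, this class being
    finite, generate such a structure. *)
Lemma cellular_finitary_exists (X : Type) :
  exists EE : set (set (X * X)), cellular_finitary EE.
Proof.
pose blk (D : set X) := diagonal `|` D `*` D.
exists (generated (blk @` [set D | finite_set D])).
apply: generated_cellular_finitary.
- move=> _ [D _ <-]; split.
  + by move=> x; left.
  + by move=> x y [/diagonalP ->|[]]; [left|right].
  move=> x y z [/diagonalP ->//|[Dx Dy]] [/diagonalP <-|[_ Dz]]; first by right.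
  by right.
- move=> _ _ [D Dfin <-] [D' Dfin' <-]; exists (blk (D `|` D')).
    by exists (D `|` D') => //=; rewrite finite_setU.
  by move=> p [[|[? ?]]|[|[? ?]]]; [left|right; split; left|left|right; split; right].
- apply/seteqP; split=> // -[x y] _; exists (blk [set x; y]); last by right; split; [left|right].
  by exists [set x; y] => //=; rewrite finite_setU; split; exact: finite_set1.
- move=> _ [D Dfin <-]; apply: uniformly_finiteU; last exact: uniformly_finite_square.
  apply: uniformly_finiteS (uniformly_finite_graph id) => p; exact: esym.
Qed.

Lemma chain_cellular_finitary {X : Type} (C : set (set (set (X * X)))) :
  C !=set0 -> (forall EE, C EE -> cellular_finitary EE) ->
  total_on C subset -> cellular_finitary (\bigcup_(EE in C) EE).
Proof.
move=> [EE0 CEE0] Ccf Ctot; split; first split.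
- by move=> E [EE /Ccf[[ent _ _ _] _ _]]; exact: ent.
- apply/seteqP; split=> // p _.
  by have [E EEE Ep] := cellular_finitary_pair (Ccf _ CEE0) p; exists E => //; exists EE0.
- move=> E F [EE CEE EEE] [FF CFF FFF].
  have [EF|FE] := Ctot _ _ CEE CFF.
    have [[_ _ mulinv _] _ _] := Ccf _ CFF.
    by have [T] := mulinv _ _ (EF _ EEE) FFF; exists T => //; exists FF.
  have [[_ _ mulinv _] _ _] := Ccf _ CEE.
  by have [T] := mulinv _ _ EEE (FE _ FFF); exists T => //; exists EE.
- move=> E F [EE CEE EEE] Fent FE; exists EE => //.
  by have [[_ _ _ sub] _ _] := Ccf _ CEE; exact: sub FE.
- exists [set E | (\bigcup_(EE in C) EE) E /\ equiv E]; last by move=> E [].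
  split=> [E []//|E [EE CEE EEE]].
  have [G [EEG Geq sG]] := cellular_finitary_directed (Ccf _ CEE) _ _ EEE EEE.
  by exists G; [split=> //; exists EE|move=> p Ep; apply: sG; left].
- by move=> E [EE /Ccf[_ _]]; exact.
Qed.

Lemma maximal_cellular_finitary_exists (X : Type) :
  exists EE : set (set (X * X)), maximal_cellular_finitary EE.
Proof.
have [EE0 EE0cf] := cellular_finitary_exists X.
(* The empty family is admitted as the union of the empty chain. *)
pose P := [set EE : set (set (X * X)) | EE = set0 \/ cellular_finitary EE].
have [EE [PEE EEmax]] : exists EE, P EE /\ forall FF, EE `<` FF -> ~ P FF.
  apply: Zorn_bigcup => C CP Ctot.
  pose C' := C `&` [set EE | cellular_finitary EE].
  have -> : \bigcup_(EE in C) EE = \bigcup_(EE in C') EE.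
    apply/seteqP; split=> E [EE]; last by move=> [CEE _]; exists EE.
    move=> CEE EEE; exists EE => //; split=> //.
    by have [EE_0|//] := CP _ CEE; rewrite EE_0 in EEE.
  have [C'0|/nonemptyPn ->] := pselect (C' !=set0); last by left; rewrite bigcup_set0.
  right; apply: chain_cellular_finitary => //; first by move=> EE [].
  by move=> EE FF [CEE _] [CFF _]; exact: Ctot.
exists EE; split; last by move=> FF FFcf /EEmax; apply; right.
have [EE_0|EEcf] := PEE; last exact: EEcf.
have [<-|EE0n] := pselect (EE0 = EE); first exact: EE0cf.
case: (EEmax EE0); last by right.
rewrite EE_0; split=> // EE0_0; apply: EE0n; rewrite EE_0; apply/seteqP; by split.
Qed.

Lemma weight_le_continuum (EE : set (set (nat * nat))) :
  weight EE #<= continuum.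
Proof.
apply: card_le_trans (card_leT _) _.
pose h (E : set (nat * nat)) : set nat := pickle @` E.
have hT : h @` setT #= [set: set (nat * nat)].
  apply: inj_card_eq => E F _ _ hEF.
  have pinj := pcan_inj (@pickleK (nat * nat)%type).
  by apply/funext => p; rewrite -(image_inj pinj) -[RHS](image_inj pinj) -/(h E) hEF.
rewrite -(card_le_eql hT); exact: card_leT.
Qed.

Theorem lemma5p4 :
  (forall EE : set (set (nat * nat)),
     maximal_cellular_finitary EE -> indiscrete EE) /\
  Delta #<= continuum.
Proof.
have indis (EE : set (set (nat * nat))) :
    maximal_cellular_finitary EE -> indiscrete EE.
  exact: maximal_cellular_finitary_indiscrete infinite_nat.
split=> //.
have [EE EEmax] := maximal_cellular_finitary_exists nat.
have [_ _ Dmin] := DeltaP.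
apply: card_le_trans (weight_le_continuum EE).
by apply: Dmin; [exact: EEmax.1|exact: indis].
Qed.
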